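(* Let $d$ be a positive integer, $\Omega=\prod_{k=1}^M\Omega^k=\mathbb{R}^d$, $\Theta=\prod_{k=1}^M\Theta^k\subseteq\mathbb{R}^d$, and let $\Pi$ have density $\pi$ with respect to Lebesgue measure on $\mathbb{R}^d$ with $s=\sup_{\theta\in\Theta}\pi(\theta)<\infty$. Let $c(\cdot,\cdot)$ be a metric cost function on $\mathbb{R}^d$ such that, for some constant $C_{0,d}$, $c(\theta,\omega)\ge C_{0,d}\|\theta-\omega\|_1$ for all $\theta,\omega\in\mathbb{R}^d$. Let $p$ be a positive integer. Let $P_{RS}$ be a componentwise random scan accept-reject-based (ARB-RS) Markov kernel for $\Pi$ with selection probabilities $\lambda_1,\dots,\lambda_M$ and componentwise acceptance probabilities $A_{\theta^{(-k)}}(\cdot)$. If $$C_{d,\pi}=C_{0,d}\,d\left[2s^{\frac1d}(1+d)^{1+\frac1d}\right]^{-1},$$ then for every positive integer $t$ and every $\theta=(\theta^1,\dots,\theta^M)\in\Theta$, $$\mathcal{W}_c^p(P_{RS}^t(\theta,\cdot),\Pi)\ \ge\ C_{d,\pi}\left[1-\sum_{k=1}^M\lambda_kA_{\theta^{(-k)}}(\theta^k)\right]^{t\left(1+\frac1d\right)}.$$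
   Context: $\Pi$ is a probability measure on $\mathbb{R}^d$ supported on the nonempty measurable set $\Theta$; the support of $\pi$ is $\Theta$, so $\pi>0$ on $\Theta$. For $k=1,\dots,M$, $\theta^{(-k)}$ denotes the components $\{\theta^1,\dots,\theta^M\}\setminus\{\theta^k\}$; $\Pi_{\theta^{(-k)}}$ is the full conditional distribution of the $k$th component, with density $\theta^k\mapsto\pi_{\theta^{(-k)}}(\theta^k)$. ARB kernel (on a generic space with reference measure $\nu$): given proposal densities $q(x,\cdot)$ with respect to $\nu$ and an acceptance function $a(x,x')\in[0,1]$, the acceptance probability is $A(x)=\int a(x,x')q(x,x')\,d\nu(x')$ and the kernel is $P(x,B)=\int_Ba(x,x')q(x,x')\,d\nu(x')+\delta_x(B)[1-A(x)]$, where $a$ is such that the target distribution is invariant. For each $k$, $P_{\theta^{(-k)}}$ is an ARB kernel on $\Omega^k$ with invariant distribution $\Pi_{\theta^{(-k)}}$, proposal $Q_{\theta^{(-k)}}$ (which may depend on $\theta^{(-k)}$), and acceptance probability $A_{\theta^{(-k)}}(\cdot)$. The full conditional may be used as a proposal (a Gibbs update), but at least one of the updates is an ARB kernel that is not a Gibbs update. Let $\lambda_k\in(0,1)$ be the selection probability of the $k$th component, $\sum_{k=1}^M\lambda_k=1$. For $\theta=(\theta^1,\dots,\theta^M)\in\Omega$ and $B=\prod_{k=1}^MB^k$ with measurable $B^k\subseteq\Omega^k$, $$P_{RS}(\theta,B)=\sum_{k=1}^M\lambda_k\left\{P_{\theta^{(-k)}}(\theta^k,B^k)\prod_{j\ne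 k}\delta_{\theta^j}(B^j)\right\},$$ and $P_{RS}^t$ is its $t$-step kernel. Wasserstein distance of order $p$: for probability measures $\mu,\nu$, $\mathcal{W}_c^p(\mu,\nu)=\left(\inf_{\Gamma\in\mathcal{C}(\mu,\nu)}\int c(\theta,\omega)^p\,d\Gamma(\theta,\omega)\right)^{1/p}\in[0,\infty]$, where $\mathcal{C}(\mu,\nu)$ is the set of joint probability measures with marginals $\mu,\nu$ (the superscript $p$ denotes the order, not a power; $c$ is such that the integrals are defined). $\|\cdot\|_1$ is the 1-norm on $\mathbb{R}^d$. *)

(* Defs.v *)
From HB Require Import structures.
From mathcomp Require Import all_boot all_order all_algebra.
From mathcomp Require Import all_classical all_reals all_analysis.

Set Implicit Arguments.
Unset Strict Implicit.
Unset Printing Implicit Defensive.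

Import Order.TTheory GRing.Theory Num.Theory.
Local Open Scope classical_set_scope.
Local Open Scope ring_scope.

(* R^n carries the product sigma-algebra of the Borel sets of R, which is
   the Borel sigma-algebra of R^n. *)
Notation vec R n := (n.-tuple (measurableTypeR R)).

Definition vcons (R : realType) (n : nat)
    (z : measurableTypeR R * vec R n) : vec R n.+1 :=
  [the n.+1.-tuple _ of z.1 :: z.2].

Definition vuncons (R : realType) (n : nat)
    (v : vec R n.+1) : measurableTypeR R * vec R n :=
  (tnth v ord0, [tuple of behead v]).

Lemma measurable_vcons (R : realType) (n : nat) :
  measurable_fun setT (@vcons R n).
Proof. exact: measurable_cons. Qed.

Lemma measurable_vuncons (R : realType) (n : nat) :
  measurable_fun setT (@vuncons R n).
Proof.
apply: measurable_fun_pair; first exact: measurable_tnth.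
exact: measurable_behead.
Qed.

Lemma vconsK (R : realType) (n : nat) : cancel (@vcons R n) (@vuncons R n).
Proof.
by move=> [x v]; rewrite /vuncons /vcons /=; congr pair; apply: val_inj.
Qed.

Lemma vunconsK (R : realType) (n : nat) : cancel (@vuncons R n) (@vcons R n).
Proof. by move=> v; rewrite /vcons /vuncons /= [RHS]tuple_eta. Qed.

Section lebesgue_cons.
Local Open Scope ereal_scope.
Context (R : realType) (n : nat).
Context (mu : {sigma_finite_measure set (vec R n) -> \bar R}).

Definition lebesgue_cons : set (vec R n.+1) -> \bar R :=
  pushforward (@lebesgue_measure R \x mu) (@vcons R n).

Let mvcons (A : set (vec R n.+1)) : measurable A ->
  measurable (@vcons R n @^-1` A).
Proof.
by move=> mA; rewrite -[X in measurable X]setTI; exact: measurable_vcons.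
Qed.

Let lebesgue_cons0 : lebesgue_cons set0 = 0.
Proof. by rewrite /lebesgue_cons /pushforward preimage_set0 measure0. Qed.

Let lebesgue_cons_ge0 A : 0 <= lebesgue_cons A.
Proof. by rewrite /lebesgue_cons /pushforward. Qed.

Let lebesgue_cons_sigma_additive : semi_sigma_additive lebesgue_cons.
Proof.
move=> F mF tF mUF; rewrite /lebesgue_cons /pushforward preimage_bigcup.
apply: measure_semi_sigma_additive.
- by move=> k; exact: mvcons.
- apply/trivIsetP => /= i j _ _ ij; rewrite -preimage_setI.
  by move/trivIsetP : tF => /(_ _ _ _ _ ij) ->//; rewrite preimage_set0.
- by rewrite -preimage_bigcup; exact: mvcons.
Qed.

HB.instance Definition _ := isMeasure.Build _ _ _ lebesgue_cons
  lebesgue_cons0 lebesgue_cons_ge0 lebesgue_cons_sigma_additive.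

Let lebesgue_cons_sigma_finite : sigma_finite setT lebesgue_cons.
Proof.
have /sigma_finiteP[F [TF ndF Foo]] := sigma_finiteT (@lebesgue_measure R).
have /sigma_finiteP[G [TG ndG Goo]] := sigma_finiteT mu.
exists (fun k => @vuncons R n @^-1` (F k `*` G k)).
  apply/esym/seteqP; split=> // v _.
  have [i _ Fi] : (\bigcup_i F i) (vuncons v).1 by rewrite -TF.
  have [j _ Gj] : (\bigcup_j G j) (vuncons v).2 by rewrite -TG.
  exists (maxn i j) => //; split.
  - by move: Fi; exact/subsetPset/ndF/leq_maxl.
  - by move: Gj; exact/subsetPset/ndG/leq_maxr.
move=> k; have [mFk Fkoo] := Foo k; have [mGk Gkoo] := Goo k.
have mFG : measurable (F k `*` G k) by exact: measurableX.
split; first by rewrite -[X in measurable X]setTI; exact: measurable_vuncons.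
rewrite /lebesgue_cons /pushforward -comp_preimage.
rewrite (_ : _ \o _ = id) ?preimage_id; last first.
  by apply/funext => z /=; rewrite vconsK.
by rewrite product_measure1E// lte_mul_pinfty// ge0_fin_numE.
Qed.

HB.instance Definition _ :=
  Measure_isSigmaFinite.Build _ _ _ lebesgue_cons lebesgue_cons_sigma_finite.

End lebesgue_cons.

Fixpoint lebesgue_vec (R : realType) (n : nat) :
    {sigma_finite_measure set (vec R n) -> \bar R} :=
  match n with
  | 0 => @dirac _ (vec R 0) [tuple] R
  | n'.+1 => lebesgue_cons (lebesgue_vec R n')
  end.

Lemma lebesgue_vec_box (R : realType) (n : nat)
    (A : 'I_n -> set (measurableTypeR R)) : (forall i, measurable (A i)) ->
  (lebesgue_vec R n [set v | forall i, A i (tnth v i)] =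
   \prod_(i < n) lebesgue_measure (A i))%E.
Proof.
elim: n A => [|n IH] A mA; first by rewrite big_ord0 /= diracE mem_set// => -[].
rewrite big_ord_recl -IH//= /lebesgue_cons /pushforward -product_measure1E//.
  congr product_measure1; apply/seteqP; split => -[x v] /=.
    move=> h; split=> [|i]; first exact: (h ord0).
    by have := h (lift ord0 i); rewrite tnthS.
  by move=> [h1 h2] i; case: (unliftP ord0 i) => [j|] -> //; rewrite tnthS.
rewrite (_ : mkset _ = \bigcap_(i in [set: 'I_n])
    ((fun v : vec R n => tnth v i) @^-1` A (lift ord0 i))); last first.
  apply/seteqP; split=> [v /= h i _|v /= h i]; first exact: h.
  exact: (h i Logic.I).
apply: fin_bigcap_measurable => // i _.
by rewrite -[X in measurable X]setTI; apply: measurable_tnth.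
Qed.

Definition dist1 (R : realType) (n : nat) (x y : vec R n) : R :=
  \sum_(i < n) `|tnth x i - tnth y i|.

Definition is_metric (R : realType) (T : Type) (c : T -> T -> R) : Prop :=
  [/\ forall x y, 0 <= c x y,
      forall x y, c x y = 0 <-> x = y,
      forall x y, c x y = c y x &
      forall x y z, c x z <= c x y + c y z].

Definition couplings (R : realType) (dT : measure_display)
    (T : measurableType dT) (mu nu : {measure set T -> \bar R}) :
    set (probability (T * T)%type R) :=
  [set G | forall A : set T, measurable A ->
     G (A `*` setT) = mu A /\ G (setT `*` A) = nu A].

Definition wasserstein (R : realType) (dT : measure_display)
    (T : measurableType dT) (c : T -> T -> R) (p : nat)
    (mu nu : {measure set T -> \bar R}) : \bar R :=
  (poweR (ereal_inf
    [set \int[G]_z ((c z.1 z.2) ^+ p)%:E | G in couplings mu nu]) p%:R^-1)%E.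

Section pkernel_comp.
Local Open Scope ereal_scope.
Context (R : realType) (dT : measure_display) (T : measurableType dT).
Context (k1 k2 : R.-pker T ~> T).

Definition pkcomp : T -> {measure set T -> \bar R} := mkcomp_noparam k1 k2.

HB.instance Definition _ := Kernel.on pkcomp.

Let pkcomp_setT x : pkcomp x setT = 1.
Proof.
rewrite /pkcomp /mkcomp_noparam /= /kcomp_noparam.
under eq_integral do rewrite prob_kernel.
by rewrite integral_cst// mul1e prob_kernel.
Qed.

HB.instance Definition _ := Kernel_isProbability.Build _ _ _ _ _
  pkcomp pkcomp_setT.

End pkernel_comp.

(* kiter P t x B is P^t(x, B), where P^(t+1)(x, B) = \int P(x, dy) P^t(y, B)
   and P^0(x, .) is the Dirac mass at x. *)
Fixpoint kiter (R : realType) (dT : measure_display) (T : measurableType dT)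
    (P : R.-pker T ~> T) (t : nat) : R.-pker T ~> T :=
  match t with
  | 0 => kdirac (@measurable_id _ T setT)
  | t'.+1 => pkcomp P (kiter P t')
  end.

(* The reference measure nu is part of the data of the kernel; it need not be
   the Lebesgue measure. *)
Record arb (R : realType) (dT : measure_display) (T : measurableType dT)
    (nu : {measure set T -> \bar R}) := ARB {
  arb_prop : T -> T -> R ;
  arb_acc : T -> T -> R ;
  arb_prop_meas : measurable_fun setT (fun z : T * T => arb_prop z.1 z.2) ;
  arb_prop_ge0 : forall x y, 0 <= arb_prop x y ;
  arb_prop_int1 : forall x, (\int[nu]_y (arb_prop x y)%:E = 1)%E ;
  arb_acc_meas : measurable_fun setT (fun z : T * T => arb_acc z.1 z.2) ;
  arb_acc01 : forall x y, 0 <= arb_acc x y <= 1 }.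

Section arb_kernel.
Context (R : realType) (dT : measure_display) (T : measurableType dT).
Context (nu : {measure set T -> \bar R}) (K : arb nu).

Definition arb_proposal (x : T) (B : set T) : \bar R :=
  (\int[nu]_(y in B) (arb_prop K x y)%:E)%E.

Definition acceptance (x : T) : R :=
  \int[nu]_y (arb_acc K x y * arb_prop K x y).

Definition arb_kernel (x : T) (B : set T) : \bar R :=
  (\int[nu]_(y in B) (arb_acc K x y * arb_prop K x y)%:E
   + \d_x B * (1 - acceptance x)%:E)%E.

Definition arb_invariant (mu : probability T R) : Prop :=
  forall B, measurable B -> (\int[mu]_x arb_kernel x B = mu B)%E.

End arb_kernel.

(* The k-th component space is R^(dk k), the full space is R^d with
   d = \sum_k dk k, and a point of R^d is the concatenation of its
   components: coordinate j of component k is coordinate tagnat.Rank k j. *)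
Section components.
Context (R : realType) (M : nat) (dk : 'I_M -> nat).

Definition totdim : nat := (\sum_(k < M) dk k)%N.

Definition component (k : 'I_M) (theta : vec R totdim) : vec R (dk k) :=
  [tuple tnth theta (@tagnat.Rank M dk k j) | j < dk k].

Definition assemble (x : forall k : 'I_M, vec R (dk k)) : vec R totdim :=
  [tuple tnth (x (@tagnat.sig1 M dk i)) (@tagnat.sig2 M dk i) | i < totdim].

Definition replace_component (k : 'I_M) (theta : vec R totdim)
    (x : vec R (dk k)) : vec R totdim :=
  assemble (dfwith (fun j => component j theta) k x).

Arguments replace_component : clear implicits.

Definition prodset (A : forall k : 'I_M, set (vec R (dk k))) :
    set (vec R totdim) :=
  [set theta | forall k, A k (component k theta)].

(* The type of theta^(-k). *)
Definition others (k : 'I_M) : Type :=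
  forall j : {j : 'I_M | j != k}, vec R (dk (val j)).

Definition drop_component (k : 'I_M) (theta : vec R totdim) : others k :=
  fun j => component (val j) theta.

Arguments drop_component : clear implicits.

Definition marginal (dens : vec R totdim -> R) (k : 'I_M)
    (theta : vec R totdim) : \bar R :=
  (\int[lebesgue_vec R (dk k)]_x (dens (replace_component k theta x))%:E)%E.

(* The family Pic of probability measures indexed by theta^(-k) is the full
   conditional of component k.  The integral of the joint density over the
   k-th component may be infinite for exceptional values of theta^(-k), for
   which no conditional density exists; nothing is imposed there. *)
Definition is_full_conditional (dens : vec R totdim -> R)
    (Theta : set (vec R totdim)) (k : 'I_M)
    (Pic : others k -> probability (vec R (dk k)) R) : Prop :=
  forall theta, Theta theta -> (marginal dens k theta < +oo)%E ->
  forall B, measurable B ->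
    Pic (drop_component k theta) B =
    (\int[lebesgue_vec R (dk k)]_(x in B)
       (dens (replace_component k theta x)
        / fine (marginal dens k theta))%:E)%E.

(* Gibbs update: the proposal is the full conditional and is always
   accepted. *)
Definition is_gibbs (Theta : set (vec R totdim)) (k : 'I_M)
    (Pic : others k -> probability (vec R (dk k)) R)
    (nu : {measure set (vec R (dk k)) -> \bar R}) (K : others k -> arb nu) :
    Prop :=
  forall theta, Theta theta ->
    (forall B, measurable B ->
       arb_proposal (K (drop_component k theta)) (component k theta) B =
       Pic (drop_component k theta) B) /\
    acceptance (K (drop_component k theta)) (component k theta) = 1.

(* A measure on R^d is determined by its values on products of measurable
   sets, so this determines the kernel P. *)
Definition is_random_scan
    (nu : forall k, {measure set (vec R (dk k)) -> \bar R})
    (K : forall k, others k -> arb (nu k)) (lambda : 'I_M -> R)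
    (P : R.-pker (vec R totdim) ~> (vec R totdim)) : Prop :=
  forall (theta : vec R totdim) (B : forall k, set (vec R (dk k))),
    (forall k, measurable (B k)) ->
    P theta (prodset B) =
    (\sum_(k < M) (lambda k)%:E *
       (arb_kernel (K k (drop_component k theta)) (component k theta) (B k) *
        \prod_(j < M | j != k) \d_(component j theta) (B j)))%E.

End components.
Arguments replace_component {R M dk} k theta x.
Arguments drop_component {R M dk} k theta.

Definition Cdpi (R : realType) (C0 : R) (d : nat) (s : R) : R :=
  C0 * d%:R *
  (2 * s `^ (d%:R^-1) * (1 + d%:R) `^ (1 + d%:R^-1))^-1.

(* Main.v *)
Require Import Defs.
From HB Require Import structures.
From mathcomp Require Import all_boot all_order all_algebra.
From mathcomp Require Import all_classical all_reals all_analysis.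
From mathcomp Require Import measurable_realfun ring lra.

(** A chain that rejects its proposal stays exactly where it is. In one step of
    the random scan kernel this happens with probability at least
    [1 - sum_k lambda_k A_k(theta)], so by the Markov property the law
    [mu = P^t(theta, .)] has at [theta] an atom of mass at least [alpha], the
    [t]-th power of that number ([random_scan_set1_ge], [kiter_set1_ge]). The
    target, on the other hand, has a density bounded by [s], so it gives a cube
    of half-width [r] around [theta] mass at most [s (2 r)^d]
    ([density_measure_le], [lebesgue_vec_cube]).

    Every coupling must therefore move mass at least [alpha - s (2 r)^d] from
    [theta] to the outside of the cube. The 1-norm dominates the max-norm, so
    each unit of this mass travels a 1-norm distance at least [r]
    ([dist1_ge_cubeC]) and costs at least [(C0 r)^p]. Hence the distance is at
    least [C0 r (alpha - s (2 r)^d)^(1/p)], and since the mass is at most 1 the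
    root can be dropped; this makes one estimate serve all orders [p]
    ([wasserstein_atom_ge]). Maximizing [r (alpha - s (2 r)^d)] over [r] leads
    to [s (2 r)^d = alpha / (1 + d)], which gives exactly the announced constant
    and the exponent [1 + 1/d] ([Cdpi_optimal_radius]). *)

Set Implicit Arguments.
Unset Strict Implicit.
Unset Printing Implicit Defensive.

Import Order.TTheory GRing.Theory Num.Theory.
Local Open Scope classical_set_scope.
Local Open Scope ring_scope.


(** * Boxes and points of R^n *)

Lemma measurable_box (R : realType) (n : nat)
    (A : 'I_n -> set (measurableTypeR R)) : (forall i, measurable (A i)) ->
  measurable [set v : vec R n | forall i, A i (tnth v i)].
Proof.
move=> mA; rewrite (_ : mkset _ = \bigcap_(i in [set: 'I_n])
    ((fun v : vec R n => tnth v i) @^-1` A i)); last first.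
  by apply/seteqP; split=> [v /= h i _|v /= h i]; [exact: h|exact: (h i Logic.I)].
apply: fin_bigcap_measurable => // i _.
by rewrite -[X in measurable X]setTI; apply: measurable_tnth.
Qed.

Lemma measurable_vec1 (R : realType) (n : nat) (x : vec R n) :
  measurable [set x].
Proof.
rewrite (_ : [set x] = [set v | forall i, [set tnth x i] (tnth v i)]).
  apply: (@measurable_box R n (fun i => [set tnth x i])) => i.
  exact: measurable_set1.
apply/seteqP; split=> [v -> //|v /= h]; apply: eq_from_tnth => i; exact: h.
Qed.

(** The random scan kernel is only given on products of component sets, so its
    atom at [theta] has to be presented as such a product. *)
Lemma prodset_set1 (R : realType) (M : nat) (dk : 'I_M -> nat)
    (theta : vec R (totdim dk)) :
  prodset (fun k => [set component k theta]) = [set theta].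
Proof.
apply/seteqP; split=> [v /= h|v -> //]; apply: eq_from_tnth => i.
have := congr1 (fun w => tnth w (tagnat.sig2 i)) (h (tagnat.sig1 i)).
by rewrite !tnth_mktuple !tagnat.sig2K.
Qed.

(** * Holding probabilities *)

Section arb_lemmas.
Context (R : realType) (dT : measure_display) (T : measurableType dT).
Context (nu : {measure set T -> \bar R}) (K : arb nu).

Lemma acceptance_ge0 x : 0 <= acceptance K x.
Proof.
apply: Rintegral_ge0 => y _; rewrite mulr_ge0 ?arb_prop_ge0//.
by have /andP[] := arb_acc01 K x y.
Qed.

Lemma acceptance_le1 x : acceptance K x <= 1.
Proof.
have mq : measurable_fun setT (arb_prop K x).
  exact: (measurableT_comp (arb_prop_meas K) (pair1_measurable x)).
have ma : measurable_fun setT (arb_acc K x).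
  exact: (measurableT_comp (arb_acc_meas K) (pair1_measurable x)).
have h0 y : 0 <= arb_acc K x y * arb_prop K x y.
  rewrite mulr_ge0 ?arb_prop_ge0//.
  by have /andP[] := arb_acc01 K x y.
have h1 : (\int[nu]_y (arb_acc K x y * arb_prop K x y)%:E <= 1)%E.
  rewrite -(arb_prop_int1 K x); apply: ge0_le_integral => //.
  - by move=> y _; rewrite lee_fin.
  - by apply/measurable_EFinP; exact: measurable_funM.
  - exact/measurable_EFinP.
  - move=> y _; rewrite lee_fin ler_piMl ?arb_prop_ge0//.
    by have /andP[] := arb_acc01 K x y.
rewrite /acceptance /Rintegral -lee_fin fineK//.
rewrite ge0_fin_numE; first exact: (le_lt_trans h1 (ltry _)).
by apply: integral_ge0 => y _; rewrite lee_fin.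
Qed.

(** An inequality, not an equality: the reference measure may have an atom at
    [x], in which case an accepted proposal can also leave the chain at [x]. *)
Lemma arb_kernel_set1_ge x :
  ((1 - acceptance K x)%:E <= arb_kernel K x [set x])%E.
Proof.
rewrite /arb_kernel diracE mem_set// mul1e leeDr//.
apply: integral_ge0 => y _; rewrite lee_fin mulr_ge0 ?arb_prop_ge0//.
by have /andP[] := arb_acc01 K x y.
Qed.

End arb_lemmas.

(** One way of being at [x] after [t] steps is never to have left it. *)
Lemma kiter_set1_ge (R : realType) (dT : measure_display)
    (T : measurableType dT) (P : R.-pker T ~> T) (x : T) (a : R) (t : nat) :
  measurable [set x] -> 0 <= a -> (a%:E <= P x [set x])%E ->
  ((a ^+ t)%:E <= kiter P t x [set x])%E.
Proof.
move=> mx a0 aP; elim: t => [|t IH].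
  by rewrite /= /kdirac/= diracE mem_set.
rewrite /= /pkcomp /mkcomp_noparam /= /kcomp_noparam.
apply: (@le_trans _ _ (\int[P x]_(y in [set x]) (a ^+ t)%:E)%E).
  rewrite integral_cst// exprSr EFinM lee_wpmul2l// lee_fin exprn_ge0//.
apply: (@le_trans _ _ (\int[P x]_(y in [set x]) kiter P t y [set x])%E).
  apply: ge0_le_integral => //.
  - by move=> y _; rewrite lee_fin exprn_ge0.
  - exact: (measurable_funS measurableT _ (measurable_kernel (kiter P t) _ mx)).
  - by move=> y ->.
apply: ge0_subset_integral => //.
exact: measurable_kernel.
Qed.

Section random_scan.
Context (R : realType) (M : nat) (dk : 'I_M -> nat).
Context (nu : forall k, {measure set (vec R (dk k)) -> \bar R}).
Context (K : forall k, others R dk k -> arb (nu k)) (lambda : 'I_M -> R).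
Hypothesis lambda_ge0 : forall k, 0 <= lambda k.
Hypothesis lambda_sum1 : \sum_(k < M) lambda k = 1.

(** Whatever component is selected, a rejected update of that component leaves
    the whole vector unchanged, since the other components are kept anyway. *)
Lemma random_scan_set1_ge (P : R.-pker (vec R (totdim dk)) ~> (vec R (totdim dk)))
    (theta : vec R (totdim dk)) : is_random_scan K lambda P ->
  ((1 - \sum_(k < M) lambda k *
      acceptance (K (drop_component k theta)) (component k theta))%:E
   <= P theta [set theta])%E.
Proof.
move=> PE; rewrite -prodset_set1 PE; last by move=> k; exact: measurable_vec1.
rewrite -[X in (X - _)%:E]lambda_sum1 -sumrB -sumEFin; apply: lee_sum => k _.
rewrite -{1}[lambda k]mulr1 -mulrBr EFinM lee_wpmul2l ?lee_fin//.
rewrite big1 => [|j _]; last by rewrite diracE mem_set.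
rewrite mule1; exact: arb_kernel_set1_ge.
Qed.

Lemma mean_acceptance_itv (theta : vec R (totdim dk)) :
  0 <= 1 - \sum_(k < M) lambda k *
      acceptance (K (drop_component k theta)) (component k theta) <= 1.
Proof.
apply/andP; split.
  rewrite subr_ge0 -lambda_sum1; apply: ler_sum => k _.
  by rewrite ler_piMr// acceptance_le1.
rewrite gerBl; apply: sumr_ge0 => k _.
by rewrite mulr_ge0// acceptance_ge0.
Qed.

End random_scan.

(** * Mass of a small cube under a bounded density *)

Definition cube (R : realType) (n : nat) (x : vec R n) (r : R) : set (vec R n) :=
  [set v | forall i, `]tnth x i - r, tnth x i + r[%classic (tnth v i)].

Lemma measurable_cube (R : realType) (n : nat) (x : vec R n) (r : R) :
  measurable (cube x r).
Proof.
apply: (@measurable_box R n (fun i => `]tnth x i - r, tnth x i + r[%classic)).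
by move=> i; exact: measurable_itv.
Qed.

Lemma lebesgue_vec_cube (R : realType) (n : nat) (x : vec R n) (r : R) :
  0 < r -> lebesgue_vec R n (cube x r) = ((2 * r) ^+ n)%:E.
Proof.
move=> r0; rewrite (@lebesgue_vec_box _ _
  (fun i => `]tnth x i - r, tnth x i + r[%classic)); last by move=> i; exact: measurable_itv.
rewrite (eq_bigr (fun=> (2 * r)%:E)) => [|i _].
  by rewrite prodEFin prodr_const card_ord.
rewrite lebesgue_measure_itv/= lte_fin ifT; last by lra.
by rewrite -EFinD; congr EFin; lra.
Qed.

Lemma dist1_ge_cubeC (R : realType) (n : nat) (x y : vec R n) (r : R) :
  ~ cube x r y -> r <= dist1 x y.
Proof.
move=> /existsNP[i /negP]; rewrite in_itv/= => ri.
have {}ri : r <= `|tnth x i - tnth y i|.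
  rewrite leNgt; apply: contra ri; rewrite ltr_norml => /andP[h1 h2].
  by apply/andP; split; lra.
apply: (le_trans ri); rewrite /dist1 (bigD1 i)//= lerDl.
by apply: sumr_ge0.
Qed.

Lemma density_measure_le (R : realType) (dT : measure_display)
    (T : measurableType dT) (mu : {measure set T -> \bar R}) (f : T -> R)
    (s : R) (B : set T) : measurable_fun setT f -> (forall x, 0 <= f x <= s) ->
  measurable B -> (\int[mu]_(x in B) (f x)%:E <= s%:E * mu B)%E.
Proof.
move=> mf fs mB; rewrite -integral_cst//; apply: ge0_le_integral => //.
- by move=> x _; rewrite lee_fin; have /andP[] := fs x.
- by apply/measurable_EFinP; exact: (measurable_funS measurableT).
- by move=> x _; rewrite lee_fin; have /andP[] := fs x.
Qed.

(** * Transporting an atom *)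

(** A coupling starts with mass at least [a] at [x] and can place at most [b] of
    it in [B]; the rest, at least [a - b], is moved at cost at least [r ^+ p].
    The lower bound is independent of [p] because
    [(a - b) ^+ p <= a - b] for [a - b] in the unit interval. *)
Lemma wasserstein_atom_ge (R : realType) (dT : measure_display)
    (T : measurableType dT) (c : T -> T -> R) (p : nat)
    (mu nu : {measure set T -> \bar R}) (x : T) (B : set T) (r a b : R) :
  (0 < p)%N -> (forall y z, 0 <= c y z) ->
  measurable_fun setT (fun z : T * T => c z.1 z.2) ->
  measurable [set x] -> measurable B ->
  0 <= r -> (forall y, ~ B y -> r <= c x y) ->
  (a%:E <= mu [set x])%E -> (nu B <= b%:E)%E -> 0 <= a - b <= 1 ->
  ((r * (a - b))%:E <= wasserstein c p mu nu)%E.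
Proof.
move=> p0 c0 mc mx mB r0 rc amu nub /andP[ab0 ab1].
have inf_ge : (((r * (a - b)) ^+ p)%:E <= ereal_inf
    [set \int[G]_z ((c z.1 z.2) ^+ p)%:E | G in couplings mu nu])%E.
  apply/ereal_infP => _ [G cG <-].
  pose S := [set x] `*` ~` B.
  have mS : measurable S by apply: measurableX => //; exact: measurableC.
  have mTB : measurable (setT `*` B : set (T * T)) by exact: measurableX.
  have GS : ((a - b)%:E <= G S)%E.
    have h : (a%:E <= G S + b%:E)%E.
      apply: (le_trans amu); rewrite -(cG _ mx).1.
      apply: (@le_trans _ _ (G (S `|` setT `*` B))).
        apply: le_measure; rewrite ?inE; [exact: measurableX|exact: measurableU|].
        move=> [y z] /= [-> _]; have [Bz|Bz] := pselect (B z); first by right.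
        by left.
      apply: (le_trans (measureU2 _ mS mTB)); rewrite leeD2l//.
      by move: nub; rewrite -(cG _ mB).2.
    by rewrite EFinB leeBlDr.
  have mcp : measurable_fun setT (fun z : T * T => (c z.1 z.2 ^+ p)%:E).
    by apply/measurable_EFinP; exact: measurable_funX.
  apply: (@le_trans _ _ (\int[G]_(z in S) (r ^+ p)%:E)%E); last first.
    apply: (@le_trans _ _ (\int[G]_(z in S) (c z.1 z.2 ^+ p)%:E)%E).
      apply: ge0_le_integral => //.
      - by move=> z _; rewrite lee_fin exprn_ge0.
      - exact: (measurable_funS measurableT).
      - move=> [y z] [/= -> Bz]; rewrite lee_fin lerXn2r ?nnegrE//.
        exact: rc.
    apply: ge0_subset_integral => //.
    by move=> z _; rewrite lee_fin exprn_ge0.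
  rewrite integral_cst// exprMn EFinM lee_wpmul2l ?lee_fin ?exprn_ge0//.
  apply: (le_trans _ GS); rewrite lee_fin.
  by case: (p) p0 => // q _; rewrite exprS ler_piMr// exprn_ile1.
rewrite /wasserstein.
have -> : (r * (a - b))%:E = poweR ((r * (a - b)) ^+ p)%:E p%:R^-1.
  rewrite poweR_EFin -powR_mulrn ?mulr_ge0// -powRrM mulfV ?pnatr_eq0 -?lt0n//.
  by rewrite powRr1// mulr_ge0.
have l0 : (0 <= ((r * (a - b)) ^+ p)%:E)%E by rewrite lee_fin exprn_ge0// mulr_ge0.
apply: gt0_ler_poweR => //; rewrite in_itv/= leey andbT//.
exact: (le_trans l0).
Qed.

(** The radius is the critical point of [r * (alpha - s * (2 * r) ^+ n)]. There
    the cube absorbs the fraction [1 / (1 + n)] of the atom, and the remaining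
    fraction [n / (1 + n)] produces the factor [n] in the constant. *)
Lemma Cdpi_optimal_radius (R : realType) (C0 s alpha : R) (n : nat) :
  (0 < n)%N -> 0 < s -> 0 < alpha ->
  let r := (alpha / (s * (1 + n%:R))) `^ n%:R^-1 / 2 in
  0 < r /\ s * (2 * r) ^+ n = alpha / (1 + n%:R) /\
  C0 * r * (alpha - alpha / (1 + n%:R)) =
    Cdpi C0 n s * alpha `^ (1 + n%:R^-1).
Proof.
move=> n0 s0 al0 r.
have nR : 0 < n%:R :> R by rewrite ltr0n.
have n1 : 0 < 1 + n%:R :> R by rewrite addr_gt0.
have sn : 0 < s * (1 + n%:R) by rewrite mulr_gt0.
split; first by rewrite divr_gt0// powR_gt0// divr_gt0.
have r2 : 2 * r = (alpha / (s * (1 + n%:R))) `^ n%:R^-1 by rewrite /r; field.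
split.
  rewrite r2 -powR_mulrn ?powR_ge0// -powRrM mulVf ?gt_eqF//.
  rewrite powRr1 ?divr_ge0 ?(ltW sn) ?(ltW al0)//.
  by field; rewrite !gt_eqF.
rewrite /Cdpi !powRD ?gt_eqF ?implybT// !powRr1 ?(ltW al0) ?(ltW n1)//.
have -> : r = (alpha `^ n%:R^-1 / (s `^ n%:R^-1 * (1 + n%:R) `^ n%:R^-1)) / 2.
  rewrite /r powRM ?invr_ge0 ?(ltW al0) ?(ltW sn)//; congr (_ * _ / _).
  rewrite -powRM ?(ltW s0) ?(ltW n1)// -(powR_inv1 (ltW sn)) -powRrM.
  by rewrite mulN1r powRN.
by field; rewrite !gt_eqF ?powR_gt0.
Qed.

Theorem theorem7 (R : realType) (M : nat) (dk : 'I_M -> nat)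
    (d_gt0 : (0 < totdim dk)%N)
    (Thetak : forall k : 'I_M, set (vec R (dk k)))
    (Theta_meas : measurable (prodset Thetak))
    (Theta_nonempty : prodset Thetak !=set0)
    (dens : vec R (totdim dk) -> R)
    (dens_meas : measurable_fun setT dens)
    (dens_ge0 : forall theta, 0 <= dens theta)
    (dens_supp : [set theta | 0 < dens theta] = prodset Thetak)
    (dens_bounded : has_ubound (dens @` prodset Thetak))
    (Pi : probability (vec R (totdim dk)) R)
    (Pi_dens : forall B, measurable B ->
       (Pi B = \int[lebesgue_vec R (totdim dk)]_(theta in B) (dens theta)%:E)%E)
    (c : vec R (totdim dk) -> vec R (totdim dk) -> R)
    (c_metric : is_metric c)
    (c_meas : measurable_fun setT
       (fun z : vec R (totdim dk) * vec R (totdim dk) => c z.1 z.2))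
    (C0 : R)
    (c_lower : forall theta omega, C0 * dist1 theta omega <= c theta omega)
    (p : nat) (p_gt0 : (0 < p)%N)
    (Pic : forall k : 'I_M, others R dk k -> probability (vec R (dk k)) R)
    (Pic_cond : forall k, is_full_conditional dens (prodset Thetak) (Pic k))
    (nu : forall k : 'I_M, {sigma_finite_measure set (vec R (dk k)) -> \bar R})
    (K : forall k : 'I_M, others R dk k -> arb (nu k))
    (K_inv : forall k theta, prodset Thetak theta ->
       arb_invariant (K k (drop_component k theta))
         (Pic k (drop_component k theta)))
    (K_not_all_gibbs : exists k, ~ is_gibbs (prodset Thetak) (Pic k) (K k))
    (lambda : 'I_M -> R)
    (lambda01 : forall k, 0 < lambda k < 1)
    (lambda_sum1 : \sum_(k < M) lambda k = 1)
    (PRS : R.-pker (vec R (totdim dk)) ~> (vec R (totdim dk)))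
    (PRS_def : is_random_scan K lambda PRS)
    (t : nat) (t_gt0 : (0 < t)%N)
    (theta : vec R (totdim dk)) (theta_in : prodset Thetak theta) :
  ((Cdpi C0 (totdim dk) (sup (dens @` prodset Thetak)) *
    (1 - \sum_(k < M) lambda k *
           acceptance (K k (drop_component k theta)) (component k theta))
      `^ (t%:R * (1 + (totdim dk)%:R^-1)))%:E
   <= wasserstein c p (kiter PRS t theta) Pi)%E.
Proof.
set A := \sum_(k < M) _; set s := sup _; set d := totdim dk.
have lambda_ge0 k : 0 <= lambda k by have /andP[/ltW] := lambda01 k.
(* Off the support the density is 0, so s bounds it everywhere. *)
have dens_le y : 0 <= dens y <= s.
  rewrite dens_ge0/=; have [Ty|/negP] := boolP (0 < dens y).
    by apply: ub_le_sup => //; exists y => //; rewrite -dens_supp.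
  move=> Ty; have -> : dens y = 0.
    by apply/eqP; rewrite eq_le dens_ge0 andbT leNgt; exact/negP.
  apply: (le_trans (dens_ge0 theta)); apply: ub_le_sup => //; by exists theta.
have s_gt0 : 0 < s.
  have : 0 < dens theta by move: theta_in; rewrite -dens_supp.
  by move/lt_le_trans; apply; have /andP[] := dens_le theta.
have [c_ge0 _ _ _] := c_metric.
have /andP[a_ge0 a_le1] : 0 <= 1 - A <= 1 by exact: mean_acceptance_itv.
have stay : (((1 - A) ^+ t)%:E <= kiter PRS t theta [set theta])%E.
  apply: kiter_set1_ge => //; first exact: measurable_vec1.
  exact: random_scan_set1_ge.
have -> : (1 - A) `^ (t%:R * (1 + d%:R^-1)) = ((1 - A) ^+ t) `^ (1 + d%:R^-1).
  by rewrite powRrM powR_mulrn.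
move: stay; set alpha := (1 - A) ^+ t => stay.
have alpha_ge0 : 0 <= alpha by exact: exprn_ge0.
have alpha_le1 : alpha <= 1 by exact: exprn_ile1.
have d0 : 0 < d%:R :> R by rewrite ltr0n.
(* For C0 <= 0 or alpha = 0 the left-hand side is nonpositive. *)
have [C0_le0|C0_gt0] := leP C0 0.
  apply: (@le_trans _ _ 0%E); last exact: poweR_ge0.
  rewrite lee_fin mulr_le0_ge0 ?powR_ge0// /Cdpi mulr_le0_ge0 ?mulr_le0_ge0//.
  by rewrite invr_ge0 !mulr_ge0 ?powR_ge0.
have [alpha_le0|alpha_gt0] := leP alpha 0.
  have -> : alpha = 0 by apply/eqP; rewrite eq_le alpha_le0.
  rewrite powR0 ?mulr0; first exact: poweR_ge0.
  by rewrite gt_eqF// addr_gt0// invr_gt0.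
have [r_gt0 [volE <-]] := Cdpi_optimal_radius C0 d_gt0 s_gt0 alpha_gt0.
move: r_gt0 volE; set r := (X in 0 < X); move=> r_gt0 volE.
have d1 : 0 < 1 + d%:R :> R by rewrite addr_gt0.
apply: (@wasserstein_atom_ge _ _ _ _ _ _ _ theta (cube theta r)) => //.
- exact: measurable_vec1.
- exact: measurable_cube.
- by rewrite mulr_ge0// ltW.
- move=> y /dist1_ge_cubeC ry; apply: le_trans (c_lower _ _).
  by rewrite ler_wpM2l// ltW.
- change (Pi (cube theta r) <= (alpha / (1 + d%:R))%:E)%E.
  rewrite Pi_dens; last exact: measurable_cube.
  rewrite -volE EFinM -(lebesgue_vec_cube theta r_gt0).
  apply: density_measure_le => //; exact: measurable_cube.
- have h : 0 <= alpha / (1 + d%:R) <= alpha.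
    rewrite divr_ge0 ?(ltW d1)//= ler_pdivrMr// ler_peMr// lerDl.
    exact: ltW.
  by case/andP: h => *; apply/andP; split; lra.
Qed.
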